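(* Let $X$ be a real Hilbert space, let $m\in\{1,2,\dots\}$, and let $R:X\to X$ be a linear isometry with $R^m=\mathrm{Id}$. Let $A=\frac1m\sum_{i=1}^m R^i$ and $S=R-\mathrm{Id}$. Then the following hold: (i) $\ker A=\ker A^*=(\operatorname{Fix}R)^\perp=(\operatorname{Fix}R^* )^\perp$. (ii) $A=P_{\operatorname{Fix}R}=P_{\operatorname{Fix}R^*}=A^*$. In particular, $\operatorname{ran}A=\operatorname{ran}A^*=\operatorname{Fix}R$ is closed. (iii) $\operatorname{ran}S=(\operatorname{Fix}R)^\perp=\operatorname{ran}S^*$. In particular, $\operatorname{ran}S=\operatorname{ran}S^*$ is closed.
   Context: An isometry is a map with $\|Rx\|=\|x\|$ for all $x$ ($R$ linear). For an operator $N:X\to X$, $\operatorname{Fix}N=\{x\in X: Nx=x\}$, $\ker N=\{x: Nx=0\}$ and $\operatorname{ran}N=N(X)$. $N^*$ denotes the Hilbert adjoint of a linear operator $N$. $P_C$ is the orthogonal projection onto a nonempty closed convex set $C$. *)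

(* Defs.v *)
From HB Require Import structures.
From mathcomp Require Import all_boot all_order all_algebra.
From mathcomp Require Import all_classical all_reals all_analysis.
Import Order.TTheory GRing.Theory Num.Theory.
Import numFieldNormedType.Exports.
Set Implicit Arguments.
Unset Strict Implicit.
Unset Printing Implicit Defensive.
Local Open Scope classical_set_scope.
Local Open Scope ring_scope.

(* A real Hilbert space is a complete normed module [X] with a symmetric
   positive definite bilinear form [dot : {dot X for idfun}] inducing its norm. *)
Definition norm_from_dot (K : realType) (X : completeNormedModType K)
    (dot : {dot X for idfun}) : Prop :=
  forall x : X, `|x| ^+ 2 = dot x x.

Definition linear_isometry (K : realType) (X : normedModType K)
    (N : {linear X -> X}) : Prop :=
  forall x : X, `|N x| = `|x|.

Definition Fix (X : Type) (N : X -> X) : set X := [set x | N x = x].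

Definition ker (X : zmodType) (N : X -> X) : set X := [set x | N x = 0].

Definition orthocomp (K : realType) (X : completeNormedModType K)
    (dot : {dot X for idfun}) (C : set X) : set X :=
  [set x | forall y, C y -> dot x y = 0].

Definition is_adjoint (K : realType) (X : completeNormedModType K)
    (dot : {dot X for idfun}) (N M : X -> X) : Prop :=
  forall x y : X, dot (N x) y = dot x (M y).

(* An adjoint is unique when it exists, which is the case for every continuous
   linear [N] on a Hilbert space; [xget] returns the default value [0]
   otherwise. *)
Definition adjoint (K : realType) (X : completeNormedModType K)
    (dot : {dot X for idfun}) (N : X -> X) : X -> X :=
  xget (fun=> 0) [set M : X -> X | is_adjoint dot N M].

Definition nearest_point (K : realType) (X : normedModType K)
    (C : set X) (x p : X) : Prop :=
  C p /\ forall q, C q -> `|x - p| <= `|x - q|.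

(* In a Hilbert space the nearest point exists and is unique as soon as [C] is
   nonempty, closed and convex. *)
Definition metric_proj (K : realType) (X : normedModType K) (C : set X) : X -> X :=
  fun x => xget 0 [set p | nearest_point C x p].

(* Main.v *)
Require Import Defs.
From HB Require Import structures.
From mathcomp Require Import all_boot all_order all_algebra.
From mathcomp Require Import all_classical all_reals all_analysis.
From mathcomp Require Import ring.
Import Order.TTheory GRing.Theory Num.Theory.
Import numFieldNormedType.Exports.
Set Implicit Arguments.
Unset Strict Implicit.
Unset Printing Implicit Defensive.
Local Open Scope classical_set_scope.
Local Open Scope ring_scope.

(** The finite-order isometry [R] is unitary, with adjoint [iter m.-1 R].
    Hence [R] and its adjoint have the same fixed points, and the average [A]
    over the cyclic group generated by [R] is the orthogonal projector onto
    [Fix R]: [A x] is fixed because applying [R] merely rotates the sum, and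
    [x - A x] is orthogonal to every fixed [y] because [R ^ i x] and [x] have
    the same inner product with [y = R ^ i y] ([average_orthoproj]).

    Parts (i) and (ii) are then general facts about a map [P] such that [P x]
    lies in [C] and [x - P x] is orthogonal to [C]: such a [P] is self-adjoint,
    is the nearest-point map of [C], has range [C] and kernel the orthogonal
    complement of [C]; and [C], being its own double orthocomplement, is
    closed ([is_orthoproj] and the lemmas about it).

    For (iii), fixed vectors are orthogonal to [R x - x] by unitarity.
    Conversely, if [x] is orthogonal to [Fix R] then [A x = 0], so [x] is the
    average of the differences [x - R ^ i x], and each of these telescopes to a
    value of [R - Id] ([sub_average_telescope]). So the range of [R - Id] is an
    orthocomplement, thus closed, and it is also the range of
    [R^-1 - Id = - (R - Id) R^-1], the adjoint of [R - Id]. *)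

(** * Inner products and adjoints *)

Lemma dotC (K : realType) (X : completeNormedModType K)
    (dot : {dot X for idfun}) (x y : X) : dot x y = dot y x.
Proof. by rewrite hermC expr0 mul1r. Qed.

Lemma dotDl (K : realType) (X : completeNormedModType K)
    (dot : {dot X for idfun}) (x y z : X) : dot (x + y) z = dot x z + dot y z.
Proof. exact: (linearDl dot). Qed.

Lemma dotDr (K : realType) (X : completeNormedModType K)
    (dot : {dot X for idfun}) (x y z : X) : dot x (y + z) = dot x y + dot x z.
Proof. exact: (linearDr dot). Qed.

Lemma dotBl (K : realType) (X : completeNormedModType K)
    (dot : {dot X for idfun}) (x y z : X) : dot (x - y) z = dot x z - dot y z.
Proof. exact: (linearBl dot). Qed.

Lemma dotBr (K : realType) (X : completeNormedModType K)
    (dot : {dot X for idfun}) (x y z : X) : dot x (y - z) = dot x y - dot x z.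
Proof. exact: (linearBr dot). Qed.

Lemma dotZl (K : realType) (X : completeNormedModType K)
    (dot : {dot X for idfun}) (a : K) (x y : X) : dot (a *: x) y = a * dot x y.
Proof. exact: (linearZl_LR dot). Qed.

Lemma dot_suml (K : realType) (X : completeNormedModType K)
    (dot : {dot X for idfun}) (I : Type) (r : seq I) (F : I -> X) (y : X) :
  dot (\sum_(i <- r) F i) y = \sum_(i <- r) dot (F i) y.
Proof. exact: (linear_sumlz dot). Qed.

Lemma dot_eq0 (K : realType) (X : completeNormedModType K)
    (dot : {dot X for idfun}) (hdot : norm_from_dot dot) (x : X) :
  dot x x = 0 -> x = 0.
Proof. by rewrite -hdot => /eqP; rewrite sqrf_eq0 normr_eq0 => /eqP. Qed.

Lemma polarization (K : realType) (X : completeNormedModType K)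
    (dot : {dot X for idfun}) (hdot : norm_from_dot dot) (x y : X) :
  dot x y = 2^-1 * (`|x + y| ^+ 2 - `|x| ^+ 2 - `|y| ^+ 2).
Proof.
rewrite !hdot dotDl !dotDr (dotC _ y x).
by field.
Qed.

Lemma isometry_dot (K : realType) (X : completeNormedModType K)
    (dot : {dot X for idfun}) (hdot : norm_from_dot dot)
    (R : {linear X -> X}) (hR : linear_isometry R) (x y : X) :
  dot (R x) (R y) = dot x y.
Proof. by rewrite !(polarization hdot) -linearD !hR. Qed.

Lemma adjointE (K : realType) (X : completeNormedModType K)
    (dot : {dot X for idfun}) (hdot : norm_from_dot dot) (N M : X -> X) :
  is_adjoint dot N M -> adjoint dot N = M.
Proof.
move=> NM; apply: xget_unique => // M' NM'.
apply/funext => y; apply/eqP; rewrite -subr_eq0; apply/eqP.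
by apply: (dot_eq0 hdot); rewrite dotBr -NM -NM' subrr.
Qed.

(** By polarization [dot ^~ y] is continuous, so an orthocomplement is an
    intersection of closed sets. *)
Lemma closed_orthocomp (K : realType) (X : completeNormedModType K)
    (dot : {dot X for idfun}) (hdot : norm_from_dot dot) (C : set X) :
  closed (orthocomp dot C).
Proof.
have -> : orthocomp dot C = \bigcap_(y in C) (dot ^~ y @^-1` [set 0]).
  by apply/seteqP; split => x xC y /xC.
apply: closed_bigI => y _; apply: closed_comp; last exact: closed_eq.
move=> x _; under eq_fun do rewrite (polarization hdot).
apply: cvgM; first exact: cvg_cst.
have cvgD : z + y @[z --> x] --> x + y by apply: cvgD; [exact: cvg_id|exact: cvg_cst].
apply: cvgB; last exact: cvg_cst.
by apply: cvgB; apply: cvgM; apply: cvg_norm.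
Qed.

(** * Orthogonal projectors *)

Definition is_orthoproj (K : realType) (X : completeNormedModType K)
    (dot : {dot X for idfun}) (C : set X) (P : X -> X) : Prop :=
  forall x, C (P x) /\ orthocomp dot C (x - P x).

Section OrthogonalProjector.
Variables (K : realType) (X : completeNormedModType K).
Variables (dot : {dot X for idfun}) (hdot : norm_from_dot dot).
Variables (C : set X) (P : X -> X) (hP : is_orthoproj dot C P).

Let PC x : C (P x). Proof. by case: (hP x). Qed.

Lemma orthoproj_dotr x y : C y -> dot (P x) y = dot x y.
Proof.
by move=> Cy; apply/eqP; rewrite eq_sym -subr_eq0 -dotBl (hP x).2.
Qed.

Lemma orthoproj_id x : C x -> P x = x.
Proof.
move=> Cx; apply/esym/eqP; rewrite -subr_eq0; apply/eqP/(dot_eq0 hdot).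
by rewrite dotBr !(hP x).2 ?subrr.
Qed.

(** Both sides equal [dot (P x) (P y)]. *)
Lemma orthoproj_selfadjoint : is_adjoint dot P P.
Proof.
move=> x y.
by rewrite -(orthoproj_dotr x (PC y)) dotC -orthoproj_dotr // dotC.
Qed.

Lemma orthoproj_pythagoras (x q : X) : C q ->
  `|x - q| ^+ 2 = `|x - P x| ^+ 2 + `|P x - q| ^+ 2.
Proof.
move=> Cq; have xq0 : dot (x - P x) (P x - q) = 0.
  by rewrite dotBr !(hP x).2 ?subrr.
have -> : x - q = (x - P x) + (P x - q) by rewrite subrKA.
rewrite !hdot; move: (x - P x) (P x - q) xq0 => u v uv0.
by rewrite dotDl !dotDr (dotC _ v u) uv0 addr0 add0r.
Qed.

Lemma metric_projE : metric_proj C = P.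
Proof.
apply/funext => x; apply: xget_unique.
  split=> // q Cq; rewrite -(@ler_pXn2r _ 2) ?nnegrE //.
  by rewrite (orthoproj_pythagoras _ Cq) lerDl exprn_ge0.
move=> q [Cq /(_ _ (PC x))].
rewrite -(@ler_pXn2r _ 2) ?nnegrE // (orthoproj_pythagoras _ Cq).
rewrite gerDl => le0; apply/esym/eqP; rewrite -subr_eq0 -normr_eq0 -sqrf_eq0.
by rewrite eq_le le0 exprn_ge0.
Qed.

Lemma ker_orthoproj : ker P = orthocomp dot C.
Proof.
apply/seteqP; split => x /=.
  by move=> Px0; have [_] := hP x; rewrite Px0 subr0.
move=> xC; apply: (dot_eq0 hdot).
by rewrite orthoproj_dotr // xC.
Qed.

Lemma range_orthoproj : range P = C.
Proof.
apply/seteqP; split => x; first by case=> y _ <-.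
by move=> /orthoproj_id Px; exists x.
Qed.

Lemma orthoproj_biortho : orthocomp dot (orthocomp dot C) = C.
Proof.
apply/seteqP; split => x; last by move=> Cx y yC; rewrite dotC yC.
move=> xCC; suff <- : P x = x by [].
apply/esym/eqP; rewrite -subr_eq0; apply/eqP/(dot_eq0 hdot).
by rewrite dotBl xCC ?(dotC _ (P x)) ?(hP x).2 ?subrr //; exact: (hP x).2.
Qed.

Lemma orthoproj_closed : closed C.
Proof. by rewrite -orthoproj_biortho; exact: closed_orthocomp. Qed.

End OrthogonalProjector.

(** * Linear isometries of finite order *)

Section FiniteOrderIsometry.
Variables (K : realType) (X : completeNormedModType K).
Variables (dot : {dot X for idfun}) (hdot : norm_from_dot dot).
Variables (m : nat) (hm : (1 <= m)%N).
Variables (R : {linear X -> X}) (hR : linear_isometry R).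
Hypothesis hRm : forall x : X, iter m R x = x.

Let Rinv : X -> X := iter m.-1 R.
Let A : X -> X := fun x => m%:R^-1 *: \sum_(1 <= i < m.+1) iter i R x.

Lemma iter_predK x : R (Rinv x) = x.
Proof. by rewrite -iterS prednK. Qed.

Lemma iter_pred_cancel x : Rinv (R x) = x.
Proof. by rewrite /Rinv -iterSr prednK. Qed.

Lemma adjoint_iter_pred : is_adjoint dot R Rinv.
Proof. by move=> x y; rewrite -{1}(iter_predK y) isometry_dot. Qed.

Lemma Fix_iter_pred : Fix Rinv = Fix R.
Proof.
apply/seteqP; split => x xE.
  by have := iter_predK x; rewrite (xE : Rinv x = x).
by have := iter_pred_cancel x; rewrite (xE : R x = x).
Qed.

Lemma dot_iter_fixed i x y : Fix R y -> dot (iter i R x) y = dot x y.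
Proof.
by move=> Ry; elim: i => //= i <-; rewrite -{1}Ry isometry_dot.
Qed.

Lemma average_orthoproj : is_orthoproj dot (Fix R) A.
Proof.
move=> x; split.
  rewrite /Fix /A /= linearZ; congr (_ *: _).
  (* The term of index m + 1 of the shifted sum is the term of index 1. *)
  rewrite linear_sum big_nat_recr //= [RHS]big_nat_recl //= hRm [RHS]addrC.
  by rewrite big_add1 /=.
move=> y Ry; rewrite dotBl /A dotZl dot_suml.
under eq_bigr do rewrite dot_iter_fixed //.
rewrite big_const_nat subSS subn0 iter_addr_0 /= -[dot x y *+ m]mulr_natl mulKf ?subrr //.
by rewrite pnatr_eq0 -lt0n.
Qed.

Lemma telescope_iter i x :
  R (\sum_(0 <= j < i) iter j R x) - \sum_(0 <= j < i) iter j R x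
  = iter i R x - x.
Proof.
by rewrite linear_sum -sumrB (telescope_sumr (fun j => iter j R x)).
Qed.

Lemma sub_average_telescope x : exists u, R u - u = x - A x.
Proof.
exists (- (m%:R^-1 *: \sum_(1 <= i < m.+1) \sum_(0 <= j < i) iter j R x)).
rewrite linearN opprK addrC linearZ -scalerBr linear_sum -sumrB.
under eq_bigr do rewrite -opprB telescope_iter opprB.
rewrite sumrB scalerBr big_const_nat subSS subn0 iter_addr_0.
by rewrite -[x *+ m]scaler_nat scalerK // pnatr_eq0 -lt0n.
Qed.

Lemma range_sub_id : range (fun x => R x - x) = orthocomp dot (Fix R).
Proof.
apply/seteqP; split => x.
  case=> u _ <- y Ry.
  by rewrite dotBl -(dot_iter_fixed 1 u Ry) subrr.
rewrite -(ker_orthoproj hdot average_orthoproj) => Ax0.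
by have [u] := sub_average_telescope x; rewrite Ax0 subr0; exists u.
Qed.

(** [Rinv - Id = (R - Id) (- Rinv)] and [R - Id = (Rinv - Id) (- R)]. *)
Lemma range_sub_id_pred :
  range (fun x => Rinv x - x) = range (fun x => R x - x).
Proof.
apply/seteqP; split => _ [x _ <-] /=.
  by exists (- Rinv x) => //; rewrite linearN iter_predK opprK addrC.
exists (- R x) => //; rewrite opprK addrC; congr (_ + _).
apply: (can_inj iter_pred_cancel).
by rewrite iter_predK linearN.
Qed.

End FiniteOrderIsometry.

Theorem theorem2p4 (K : realType) (X : completeNormedModType K)
    (dot : {dot X for idfun}) (hdot : norm_from_dot dot)
    (m : nat) (hm : (1 <= m)%N)
    (R : {linear X -> X}) (hR : linear_isometry R)
    (hRm : forall x : X, iter m R x = x) :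
  let A : X -> X := fun x => m%:R^-1 *: \sum_(1 <= i < m.+1) iter i R x in
  let S : X -> X := fun x => R x - x in
  let adj := adjoint dot in
  (* (i) *)
  [/\ ker A = ker (adj A),
      ker (adj A) = orthocomp dot (Fix R)
    & orthocomp dot (Fix R) = orthocomp dot (Fix (adj R))] /\
  (* (ii) *)
  [/\ A = metric_proj (Fix R),
      metric_proj (Fix R) = metric_proj (Fix (adj R)),
      metric_proj (Fix (adj R)) = adj A
    & [/\ range A = range (adj A), range (adj A) = Fix R & closed (Fix R)]] /\
  (* (iii) *)
  [/\ range S = orthocomp dot (Fix R),
      orthocomp dot (Fix R) = range (adj S),
      range S = range (adj S)
    & closed (range S)].
Proof.
move=> A S adj.
have projA : is_orthoproj dot (Fix R) A by exact: average_orthoproj.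
have adjA : adj A = A by apply/(adjointE hdot)/orthoproj_selfadjoint/projA.
have hRinv : is_adjoint dot R (iter m.-1 R) by exact: adjoint_iter_pred.
have FixadjR : Fix (adj R) = Fix R.
  by rewrite /adj (adjointE hdot hRinv); exact: Fix_iter_pred.
have adjS : adj S = fun x => iter m.-1 R x - x.
  by apply: (adjointE hdot) => x y; rewrite /S dotBl dotBr hRinv.
have rangeS : range S = orthocomp dot (Fix R) by exact: (range_sub_id hdot hm hR hRm).
have rangeadjS : range (adj S) = range S.
  by rewrite adjS; exact: range_sub_id_pred.
rewrite FixadjR adjA rangeadjS rangeS (metric_projE hdot projA).
rewrite (ker_orthoproj hdot projA) (range_orthoproj hdot projA).
split; [by []|split; split=> //].
- by split=> //; exact: (orthoproj_closed hdot projA).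
- exact: closed_orthocomp.
Qed.
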